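(* Let $G$ be a finitely generated group. If $G$ is exact, then $H^1_b(G,\mathcal{E})=0$ for every weak-* closed Hopf $G$-module $\mathcal{E}$ (i.e. for every bounded left Banach $G$-module $X$ and every Hopf $G$-module $\mathcal{E}\subseteq\mathcal{L}(X,\ell_\infty(G))$ that is closed in the weak-* topology of $\mathcal{L}(X,\ell_\infty(G))$).
   Context: $G$ is a discrete group generated by a finite symmetric set $S=S^{-1}$. All Banach spaces are over $\mathbb{R}$. Write $C=\ell_\infty(G)$ with the supremum norm $\|\cdot\|_C$, $1_G\in C$ for the constant function $1$, and let $G$ act on $C$ by $(g*f)(h)=f(g^{-1}h)$. For a function $f:G\to C$ write $f_g=f(g)\in C$. The uniform convolution algebra $\ell_u(G)$ is the completion of the space of finitely supported functions $f:G\to C$ in the norm $\|f\|_u=\big\|\sum_{g\in G}|f_g|\big\|_C$; its elements are regarded as functions $\xi:G\to C$. $G$ acts on $\ell_u(G)$ by isometries by $(g\star\xi)_h=g*\xi_{g^{-1}h}$. Exactness: $G$ is exact if for every $\varepsilon>0$ there is $\xi\in\ell_u(G)$ such that (a) $\xi_g=0$ for all but finitely many $g\in G$; (b) $\xi_g\ge 0$ for all $g\in G$ and $\sum_{g\in G}\xi_g=1_G$; (c) $\|\xi-s\star\xi\|_u\le\varepsilon$ for every $s\in S$. A bounded left Banach $G$-module is a Banach space $X$ with a homomorphism $\Phi$ from $G$ to the invertible bounded linear operators on $X$ with $\sup_{g}\|\Phi(g)\|<\infty$; write $gx=\Phi(g)x$. $\mathcal{L}(X,C)$ is the Banach space of bounded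 linear operators $X\to C$. It is a bounded left Banach $G$-module by $(g\cdot T)(x)=g*(T(g^{-1}x))$, and a $C$-module by $(aT)(x)=a\,T(x)$ for $a\in C$ (product in $C$). It is isometrically isomorphic to $\ell_\infty(G,X^* )$ via $T\mapsto(g\mapsto(x\mapsto T(x)(g)))$, hence is the dual of $\ell_1(G,X)$; the weak-* topology on $\mathcal{L}(X,C)$ is the one coming from this predual. A Hopf $G$-module is a Banach $G$-module $\mathcal{E}$ which, for some bounded left Banach $G$-module $X$, is a subspace $\mathcal{E}\subseteq\mathcal{L}(X,C)$ that is both a $G$-submodule for the $G$-action $(g\cdot T)(x)=g*(T(g^{-1}x))$ and a $C$-submodule for the $C$-action $(aT)(x)=a\,T(x)$. For a bounded Banach $G$-module $\mathcal{E}$, a bounded cocycle is a map $b:G\to\mathcal{E}$ with $\sup_{g}\|b(g)\|<\infty$ and $b(gh)=g\,b(h)+b(g)$ for all $g,h\in G$; it is a boundary if there is $\phi\in\mathcal{E}$ with $b(g)=g\phi-\phi$ for all $g\in G$. $H^1_b(G,\mathcal{E})$ is the quotient of the space of bounded cocycles by the subspace of boundaries. *)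

(* Defs.v *)
From HB Require Import structures.
From mathcomp Require Import all_boot all_order all_algebra.
From mathcomp Require Import all_classical all_reals all_analysis.

Set Implicit Arguments.
Unset Strict Implicit.
Unset Printing Implicit Defensive.

Import Order.TTheory GRing.Theory Num.Theory.
Import numFieldNormedType.Exports.

Local Open Scope classical_set_scope.
Local Open Scope ring_scope.

Lemma normrZ_of_le (R : realType) (V : lmodType R) (n : V -> R) :
  (forall x, 0 <= n x) -> (forall l x, n (l *: x) <= `|l| * n x) ->
  forall l x, n (l *: x) = `|l| * n x.
Proof.
move=> n0 nZ l x; apply/eqP; rewrite eq_le nZ/=.
have [->|l0] := eqVneq l 0; first by rewrite normr0 mul0r.
rewrite -ler_pdivlMl ?normr_gt0// -normfV.
by rewrite -[in leLHS](scale1r x) -(mulVf l0) -scalerA.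
Qed.

Section linfty_space.
Variables (R : realType) (G : groupType).

Definition bounded_pred : {pred G -> R} :=
  fun f => `[< exists M, forall g, `|f g| <= M >].

Record linfty := Linfty {
  linfty_fun :> G -> R;
  linftyP : linfty_fun \in bounded_pred }.

Lemma bounded_predP (f : G -> R) :
  (exists M, forall g, `|f g| <= M) -> f \in bounded_pred.
Proof. by move=> fM; apply/asboolP. Qed.

Lemma linfty_bounded (f : linfty) : exists M, forall g, `|f g| <= M.
Proof. exact/asboolP/linftyP. Qed.

Lemma bounded_submod_closed : submod_closed bounded_pred.
Proof.
split=> [|a u v /asboolP[M uM] /asboolP[N vN]]; apply: bounded_predP.
  by exists 0 => g; rewrite normr0.
exists (`|a| * M + N) => g.
by rewrite (le_trans (ler_normD _ _))// lerD// normrM ler_wpM2l.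
Qed.

HB.instance Definition _ :=
  GRing.isSubmodClosed.Build R (G -> R) bounded_pred bounded_submod_closed.
HB.instance Definition _ := [isSub for linfty_fun].
HB.instance Definition _ := [Choice of linfty by <:].
HB.instance Definition _ := [SubChoice_isSubLmodule of linfty by <:].

Definition linfty_norm (f : linfty) : R := sup (range (fun g => `|f g|)).

Lemma le_linfty_norm (f : linfty) (g : G) : `|f g| <= linfty_norm f.
Proof.
have [M fM] := linfty_bounded f; apply: ub_le_sup; last by exists g.
by exists M => _ [h _ <-].
Qed.

Lemma linfty_norm_le (f : linfty) (M : R) : (forall g, `|f g| <= M) -> linfty_norm f <= M.
Proof. by move=> fM; apply: ge_sup; [exists `|f 1%g|, 1%g|move=> _ [g _ <-]].
Qed.

Lemma ler_linfty_normD (f1 f2 : linfty) :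
  linfty_norm (f1 + f2) <= linfty_norm f1 + linfty_norm f2.
Proof.
apply: linfty_norm_le => g.
by rewrite (le_trans (ler_normD _ _))// lerD// le_linfty_norm.
Qed.

Lemma linfty_normZ (l : R) (f : linfty) : linfty_norm (l *: f) = `|l| * linfty_norm f.
Proof.
move: l f; apply: normrZ_of_le => [f|l f].
  exact: le_trans (le_linfty_norm f 1%g).
apply: linfty_norm_le => g.
by rewrite [leLHS]normrM ler_wpM2l// le_linfty_norm.
Qed.

Lemma linfty_norm0_eq0 (f : linfty) : linfty_norm f = 0 -> f = 0.
Proof.
move=> f0; apply/val_inj/funext => g; apply/normr0_eq0/eqP.
by rewrite eq_le normr_ge0 andbT -f0; exact: (le_linfty_norm f g).
Qed.

HB.instance Definition _ := Lmodule_isNormed.Build R linfty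
  ler_linfty_normD linfty_normZ linfty_norm0_eq0.

Lemma linfty_one_subproof : (fun=> 1) \in bounded_pred.
Proof. by apply: bounded_predP; exists 1 => g; rewrite normr1. Qed.

Definition linfty_one : linfty := Linfty linfty_one_subproof.

Lemma linfty_mul_subproof (a f : linfty) :
  (fun h => a h * f h) \in bounded_pred.
Proof.
apply: bounded_predP; exists (linfty_norm a * linfty_norm f) => h.
by rewrite normrM ler_pM// le_linfty_norm.
Qed.

Definition linfty_mul (a f : linfty) : linfty := Linfty (linfty_mul_subproof a f).

Lemma linfty_act_subproof (g : G) (f : linfty) :
  (fun h => f (g^-1 * h)%g) \in bounded_pred.
Proof.
apply: bounded_predP; exists (linfty_norm f) => h; exact: le_linfty_norm.
Qed.

Definition linfty_act (g : G) (f : linfty) : linfty :=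
  Linfty (linfty_act_subproof g f).

End linfty_space.

Section bounded_operators.
Variables (R : realType) (X Y : normedModType R).

Definition bounded_op_pred : {pred X -> Y} :=
  fun T => `[< linear T /\ exists M, forall x, `|T x| <= M * `|x| >].

Record bounded_op := BoundedOp {
  bounded_op_fun :> X -> Y;
  bounded_opP : bounded_op_fun \in bounded_op_pred }.

Lemma bounded_op_predP (T : X -> Y) :
  linear T -> (exists M, forall x, `|T x| <= M * `|x|) -> T \in bounded_op_pred.
Proof. by move=> Tl TM; apply/asboolP. Qed.

Lemma bounded_op_linear (T : bounded_op) : linear T.
Proof. by have /asboolP[] := bounded_opP T. Qed.

Lemma bounded_op_bounded (T : bounded_op) :
  exists M, forall x, `|T x| <= M * `|x|.
Proof. by have /asboolP[] := bounded_opP T. Qed.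

Lemma bounded_op_submod_closed : submod_closed bounded_op_pred.
Proof.
split=> [|a u v /asboolP[ul [M uM]] /asboolP[vl [N vN]]]; apply: bounded_op_predP.
- by move=> a x y; rewrite -[LHS]/(0 : Y) -[RHS]/(a *: 0 + 0) scaler0 addr0.
- by exists 0 => x; rewrite normr0 mul0r.
- move=> b x y; rewrite -[LHS]/(a *: u (b *: x + y) + v (b *: x + y)).
  rewrite -[RHS]/(b *: (a *: u x + v x) + (a *: u y + v y)).
  by rewrite ul vl !scalerDr !scalerA (mulrC a b) addrACA.
- exists (`|a| * M + N) => x; rewrite mulrDl.
  rewrite (le_trans (ler_normD _ _))// lerD// [leLHS]normrZ -mulrA.
  exact: ler_wpM2l.
Qed.

HB.instance Definition _ := GRing.isSubmodClosed.Build R (X -> Y)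
  bounded_op_pred bounded_op_submod_closed.
HB.instance Definition _ := [isSub for bounded_op_fun].
HB.instance Definition _ := [Choice of bounded_op by <:].
HB.instance Definition _ := [SubChoice_isSubLmodule of bounded_op by <:].

Definition op_norm (T : bounded_op) : R :=
  sup [set `|T x| | x in [set x | `|x| <= 1]].

Lemma bounded_op0 (T : bounded_op) : T 0 = 0.
Proof.
by have := bounded_op_linear T (-1) 0 0; rewrite scaler0 addr0 scaleN1r addNr.
Qed.

Lemma bounded_opZ (T : bounded_op) a x : T (a *: x) = a *: T x.
Proof.
by have := bounded_op_linear T a x 0; rewrite !addr0 bounded_op0 addr0.
Qed.

Lemma op_norm_ge0 (T : bounded_op) : 0 <= op_norm T.
Proof.
have [M TM] := bounded_op_bounded T; apply: ub_le_sup.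
  exists `|M| => _ [x /= x1 <-]; apply: le_trans (TM x) _.
  apply: le_trans (ler_wpM2r (normr_ge0 x) (ler_norm M)) _.
  by rewrite -[leRHS]mulr1 ler_wpM2l.
by exists 0; rewrite /= ?bounded_op0 normr0.
Qed.

Lemma le_op_norm (T : bounded_op) (x : X) : `|T x| <= op_norm T * `|x|.
Proof.
have [->|x0] := eqVneq x 0; first by rewrite bounded_op0 !normr0 mulr0.
have nx0 : 0 < `|x| by rewrite normr_gt0.
rewrite -ler_pdivrMr// mulrC -[X in X * _]gtr0_norm ?invr_gt0// -normrZ.
rewrite -bounded_opZ; have [M TM] := bounded_op_bounded T; apply: ub_le_sup.
  exists `|M| => _ [y /= y1 <-]; apply: le_trans (TM y) _.
  apply: le_trans (ler_wpM2r (normr_ge0 y) (ler_norm M)) _.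
  by rewrite -[leRHS]mulr1 ler_wpM2l.
by exists (`|x|^-1 *: x); rewrite //= normfZV.
Qed.

Lemma op_norm_le (T : bounded_op) (M : R) :
  0 <= M -> (forall x, `|T x| <= M * `|x|) -> op_norm T <= M.
Proof.
move=> M0 TM; apply: ge_sup.
  by exists `|T 0|, 0; rewrite //= normr0.
move=> _ [x /= x1 <-]; apply: le_trans (TM x) _.
by rewrite -[leRHS]mulr1 ler_wpM2l.
Qed.

Lemma ler_op_normD (T1 T2 : bounded_op) :
  op_norm (T1 + T2) <= op_norm T1 + op_norm T2.
Proof.
apply: op_norm_le => [|x]; first by rewrite addr_ge0// op_norm_ge0.
by rewrite mulrDl (le_trans (ler_normD _ _))// lerD// le_op_norm.
Qed.

Lemma op_normZ (l : R) (T : bounded_op) : op_norm (l *: T) = `|l| * op_norm T.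
Proof.
move: l T; apply: normrZ_of_le => [|l T]; first exact: op_norm_ge0.
apply: op_norm_le => [|x]; first by rewrite mulr_ge0// op_norm_ge0.
by rewrite [leLHS]normrZ -mulrA ler_wpM2l// le_op_norm.
Qed.

Lemma op_norm0_eq0 (T : bounded_op) : op_norm T = 0 -> T = 0.
Proof.
move=> T0; apply/val_inj/funext => x; apply/normr0_eq0/eqP.
by rewrite eq_le normr_ge0 andbT -(mul0r `|x|) -T0; exact: (le_op_norm T x).
Qed.

HB.instance Definition _ := Lmodule_isNormed.Build R bounded_op
  ler_op_normD op_normZ op_norm0_eq0.

End bounded_operators.

(* The invertibility of each [gact g] follows from [gact1] and [gactM]. *)
Record bounded_gmodule (R : realType) (G : groupType) (X : normedModType R) :=
  BoundedGmodule {
    gact :> G -> bounded_op X X;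
    gact1 : forall x, gact 1%g x = x;
    gactM : forall g h x, gact (g * h)%g x = gact g (gact h x);
    gact_bounded : exists M, forall g, `|gact g| <= M }.

Section group_generation.
Variable G : groupType.

Definition is_subgroup (H : set G) : Prop :=
  [/\ H 1%g, forall x y, H x -> H y -> H (x * y)%g & forall x, H x -> H x^-1%g].

Definition finite_symmetric_generating (S : set G) : Prop :=
  [/\ finite_set S, forall s, S s -> S s^-1%g &
      smallest is_subgroup S = [set: G]].

End group_generation.

Section exactness.
Variables (R : realType) (G : groupType).

Definition finitely_supported (f : G -> linfty R G) : Prop :=
  finite_set [set g | f g <> 0].

(* Extended-valued, so that it makes sense for all functions [G -> linfty R G];
   for a finitely supported [f] it is the supremum norm of the element
   [\sum_g |f g|] of [linfty R G]. *)
Definition lu_norm (f : G -> linfty R G) : \bar R :=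
  ereal_sup (range (fun h : G => \esum_(g in [set: G]) `|f g h|%:E))%E.

(* The functions with finite [lu_norm] form a Banach space, so the completion
   of the finitely supported functions is their closure in it. *)
Definition in_lu (xi : G -> linfty R G) : Prop :=
  forall e : R, 0 < e ->
    exists2 f, finitely_supported f & (lu_norm (xi - f)%R <= e%:E)%E.

Definition lu_act (g : G) (xi : G -> linfty R G) : G -> linfty R G :=
  fun h => linfty_act g (xi (g^-1 * h)%g).

Definition exact_group (S : set G) : Prop :=
  forall e : R, 0 < e -> exists xi : G -> linfty R G,
    [/\ in_lu xi,
        finitely_supported xi,
        forall g h, 0 <= xi g h,
        \sum_(g \in [set: G]) xi g = linfty_one R G &
        forall s, S s -> (lu_norm (xi - lu_act s xi)%R <= e%:E)%E].

End exactness.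

Section hopf_modules.
Variables (R : realType) (G : groupType) (X : normedModType R).
Local Notation C := (linfty R G).
Local Notation L := (bounded_op X C).

Lemma hopf_act_subproof (Phi : bounded_gmodule G X) (g : G) (T : L) :
  (fun x => linfty_act g (T (Phi g^-1%g x))) \in @bounded_op_pred R X C.
Proof.
apply: bounded_op_predP => [a x y|].
  by apply/val_inj/funext => h /=; rewrite !bounded_op_linear.
exists (`|T| * `|Phi g^-1%g|) => x; apply: linfty_norm_le => h /=.
apply: le_trans (le_linfty_norm _ _) _; apply: le_trans (le_op_norm T _) _.
by rewrite -mulrA ler_wpM2l ?op_norm_ge0 //; exact: le_op_norm.
Qed.

Definition hopf_act (Phi : bounded_gmodule G X) (g : G) (T : L) : L :=
  BoundedOp (hopf_act_subproof Phi g T).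

Lemma hopf_scale_subproof (a : C) (T : L) :
  (fun x => linfty_mul a (T x)) \in @bounded_op_pred R X C.
Proof.
apply: bounded_op_predP => [c x y|].
  apply/val_inj/funext => h /=; rewrite bounded_op_linear/=.
  by rewrite mulrDr; congr (_ + _); rewrite [LHS]mulrCA.
exists (`|a| * `|T|) => x; apply: linfty_norm_le => h /=.
rewrite normrM -mulrA ler_pM//; first exact: le_linfty_norm.
by apply: le_trans (le_linfty_norm _ _) _; exact: (le_op_norm T).
Qed.

Definition hopf_scale (a : C) (T : L) : L := BoundedOp (hopf_scale_subproof a T).

(* [hopf_closed] is what makes the subspace [E] a Banach space. *)
Record hopf_gmodule (Phi : bounded_gmodule G X) (E : set L) : Prop := HopfGmodule {
  hopf0 : E 0;
  hopf_linear : forall (a : R) (T U : L), E T -> E U -> E (a *: T + U);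
  hopf_closed : closed E;
  hopf_actP : forall g T, E T -> E (hopf_act Phi g T);
  hopf_scaleP : forall a T, E T -> E (hopf_scale a T) }.

Definition l1 : set (G -> X) :=
  [set xi | summable [set: G] (fun g => `|xi g|%:E)].

(* The sum of [T (xi g) g] over [g] in [G]. *)
Definition l1_pairing (T : L) (xi : {xi : G -> X | l1 xi}) : R :=
  let f g := (T (sval xi g) g)%:E in
  fine (\esum_(g in [set: G]) f^\+ g - \esum_(g in [set: G]) f^\- g)%E.

(* Closedness in the coarsest topology on [L] making all evaluations at elements
   of [l1] continuous. *)
Definition weak_star_closed (E : set L) : Prop :=
  closed (E : set (initial_topology
    (l1_pairing : L -> {ptws {xi : G -> X | l1 xi} -> R}))).

End hopf_modules.

Section bounded_cohomology.
Variables (R : realType) (G : groupType) (V : normedModType R).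
Variables (act : G -> V -> V) (E : set V).

Record bounded_cocycle (b : G -> V) : Prop := BoundedCocycle {
  cocycle_in : forall g, E (b g);
  cocycle_bounded : exists M, forall g, `|b g| <= M;
  cocycleM : forall g h, b (g * h)%g = act g (b h) + b g }.

Definition boundary (b : G -> V) : Prop :=
  exists2 phi, E phi & forall g, b g = act g phi - phi.

Definition cocycle_class (b : G -> V) : set (G -> V) :=
  [set c | bounded_cocycle c /\ boundary (c - b)].

(* The quotient space as its set of cosets; [cocycle_class 0] is its zero. *)
Definition H1b : set (set (G -> V)) := [set cocycle_class b | b in bounded_cocycle].

Definition H1b_eq0 : Prop := H1b = [set cocycle_class 0].

End bounded_cohomology.

(* Main.v *)
(* For a bounded cocycle [b] and finitely supported partitions of unity [xi_n]
   that are almost invariant, put [T_n = \sum_g xi_n(g) b(g)], which lies in [E]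
   and has norm at most [sup |b|]. By the cocycle identity
   [s . T_n - T_n + b(s) = \sum_g (s * xi_n - xi_n)(g) b(g)], which tends to [0]
   in norm for [s] in [S]. The pointwise limit [T] of the [T_n] along an
   ultrafilter is a weak-* limit by dominated convergence, so [T] is in [E], and
   [b(s) = s . (-T) - (-T)] on [S]; since both sides are cocycles this extends
   to the group generated by [S]. *)
Require Import Defs.
From mathcomp Require Import all_boot all_order all_algebra.
From mathcomp Require Import all_classical all_reals all_analysis.
From mathcomp Require Import finmap lra.

Set Implicit Arguments.
Unset Strict Implicit.
Unset Printing Implicit Defensive.

Import Order.TTheory GRing.Theory Num.Theory.
Import numFieldNormedType.Exports.

Local Open Scope classical_set_scope.
Local Open Scope ring_scope.

(** * Signed sums over arbitrary index sets and dominated convergence *)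

Section signed_esum.
Variables (R : realType) (T : choiceType).
Implicit Types f g c : T -> R.

(** The body of [l1_pairing] with the summand abstracted, so that [l1_pairing T xi] is convertible
    to an instance of it. *)
Definition signed_esum f : R :=
  let u t := (f t)%:E in
  fine (\esum_(t in [set: T]) u^\+ t - \esum_(t in [set: T]) u^\- t)%E.

Lemma summable_le c f : (forall t, `|f t| <= c t) ->
  (\esum_(t in [set: T]) (c t)%:E < +oo)%E -> summable [set: T] (EFin \o f).
Proof.
move=> fc; apply: le_lt_trans; apply: le_esum => t _ /=.
by rewrite lee_fin.
Qed.

Lemma signed_esum_le f g (d : R) :
  summable [set: T] (EFin \o f) -> summable [set: T] (EFin \o g) ->
  (\esum_(t in [set: T]) `|f t - g t|%:E <= d%:E)%E ->
  signed_esum f <= signed_esum g + d.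
Proof.
move=> sf sg fgd; rewrite /signed_esum.
have fin (u : T -> \bar R) : (forall t, 0 <= u t)%E -> summable [set: T] u ->
    exists a : R, (\esum_(t in [set: T]) u t)%E = a%:E.
  move=> u0 su; exists (fine (\esum_(t in [set: T]) u t)%E); rewrite fineK//.
  rewrite ge0_fin_numE ?esum_ge0//; apply: le_lt_trans su.
  by apply: le_esum => t _; exact: lee_abs.
have [a fa] := fin _ (funepos_ge0 _) (summable_funepos sf).
have [b fb] := fin _ (funeneg_ge0 _) (summable_funeneg sf).
have [a' ga] := fin _ (funepos_ge0 _) (summable_funepos sg).
have [b' gb] := fin _ (funeneg_ge0 _) (summable_funeneg sg).
(* Moving the negative parts across leaves only sums of nonnegative terms, which add and compare
   termwise: [f^+ + g^- <= g^+ + f^- + |f - g|]. *)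
have : (a%:E + b'%:E <= a'%:E + b%:E + d%:E)%E.
  rewrite -fa -fb -ga -gb; apply: le_trans (leeD (lexx _) fgd).
  rewrite -!esumD// => [|t _]; last exact: adde_ge0.
  apply: le_esum => t _ /=; rewrite !funeposE !funenegE /=.
  rewrite -!EFin_max -!EFinD lee_fin.
  have := ler_norm (f t - g t).
  by case: (leP (f t) 0); case: (leP (g t) 0); case: (leP (- f t) 0);
    case: (leP (- g t) 0); lra.
rewrite -!EFinD lee_fin fa fb ga gb => H.
by change (a - b <= a' - b' + d); lra.
Qed.

Lemma signed_esum_dist f g (d : R) :
  summable [set: T] (EFin \o f) -> summable [set: T] (EFin \o g) ->
  (\esum_(t in [set: T]) `|f t - g t|%:E <= d%:E)%E ->
  `|signed_esum f - signed_esum g| <= d.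
Proof.
move=> sf sg fgd; have gfd := fgd.
rewrite (eq_esum (b := fun t => `|g t - f t|%:E)) in gfd; last first.
  by move=> t _; rewrite distrC.
have := signed_esum_le sf sg fgd; have := signed_esum_le sg sf gfd.
by rewrite ler_norml; lra.
Qed.

(** The sum is a supremum over finite sets; a finite set that attains it up to [e] leaves at most
    [e] for its complement. *)
Lemma esum_tail c (e : R) : (forall t, 0 <= c t) -> 0 < e ->
  (\esum_(t in [set: T]) (c t)%:E < +oo)%E ->
  exists2 A : set T, finite_set A & (\esum_(t in ~` A) (c t)%:E <= e%:E)%E.
Proof.
move=> c0 e0 cfin.
have efin : (\esum_(t in [set: T]) (c t)%:E)%E \is a fin_num.
  by rewrite ge0_fin_numE// esum_ge0// => t _; rewrite lee_fin.
have [_ [A [finA _] <-]] := ub_ereal_sup_adherent e0 efin.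
rewrite -/(esum _ _) (esumID A) ?setTI; last by move=> t _; rewrite lee_fin.
rewrite esum_fset//; last by move=> t _; rewrite lee_fin.
rewrite fsumEFin//; set x := (\sum_(t \in A) c t) => H; exists A => //; move: H.
case: (\esum_(t in ~` A) (c t)%:E)%E => [r| |] //=.
  by change (x + r - e < x -> r <= e); lra.
by rewrite leNye.
Qed.

(** Off a finite set [A] the bound [c] sums to at most [e / 4]. The finitely many terms in [A]
    converge and eventually contribute at most [e / 2]; off [A] the difference is at most [c + c],
    which contributes twice [e / 4]. *)
Lemma dominated_signed_esum_cvg (I : Type) (F : set_system I) {FF : Filter F}
    (f_ : I -> T -> R) f c :
  (\esum_(t in [set: T]) (c t)%:E < +oo)%E ->
  (forall i t, `|f_ i t| <= c t) -> (forall t, `|f t| <= c t) ->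
  (forall t, f_ i t @[i --> F] --> f t) ->
  signed_esum (f_ i) @[i --> F] --> signed_esum f.
Proof.
move=> cfin fc fc' fcvg; apply/cvgrPdist_le => e e0.
have c0 t : 0 <= c t by exact: le_trans (fc' t).
have e4 : 0 < e / 4 by rewrite divr_gt0.
have [A finA Ae] := esum_tail c0 e4 cfin.
have A0 : \sum_(t <- fset_set A) `|f t - f_ i t| @[i --> F] --> (0 : R).
  rewrite -[X in _ --> X](big1_eq (op := +%R) (fset_set A) xpredT).
  apply: cvg_big => [|t _]; first exact: add_continuous.
  by apply/cvgr0Pnorm_le => d d0; near=> i; rewrite normr_id; near: i;
    move/cvgrPdist_le : (fcvg t); exact.
have e2 : 0 < e / 2 by rewrite divr_gt0.
near=> i; apply: signed_esum_dist.
- exact: summable_le cfin.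
- exact: summable_le cfin.
rewrite (esumID A)// setTI esum_fset// fsumEFin//.
have -> : e = e / 2 + (e / 4 + e / 4) by lra.
rewrite !EFinD; apply: leeD.
  rewrite lee_fin fsbig_finite//; apply: le_trans (ler_norm _) _.
  by near: i; move/cvgr0Pnorm_le : A0; exact.
apply: le_trans (leeD Ae Ae); rewrite -esumD ?setTI//; last first.
- by move=> t _; rewrite lee_fin.
- by move=> t _; rewrite lee_fin.
apply: le_esum => t _; rewrite -EFinD lee_fin.
by apply: le_trans (ler_normB _ _) _; exact: lerD.
Unshelve. all: by end_near. Qed.

End signed_esum.

(** * Ultrafilter limits of operators and weak-* closedness *)

Lemma ultrafilter_bounded_cvg (R : realType) (I : Type) (U : set_system I)
    {UU : UltraFilter U} (u : I -> R) (M : R) :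
  (forall i, `|u i| <= M) -> exists2 l, `|l| <= M & u i @[i --> U] --> l.
Proof.
(* The image of [U] is maximal, since a strictly finer filter would contain both a set and its
   complement. Compactness of [[-M, M]] then gives the limit. *)
move=> uM; have UuU : UltraFilter (u @ U).
  split=> [|G GG uUG]; first exact: fmap_proper_filter.
  apply/seteqP; split=> // A GA; apply: contrapT => nUA.
  have [/nUA//|UnA] := in_ultra_setVsetC (u @^-1` A) UU.
  have : G (A `&` ~` A) by apply: filterI => //; exact: uUG.
  by rewrite setICr => /filter_not_empty.
have := @segment_compact R (- M) M; rewrite compact_ultra.
have uMU : (u @ U) `[- M, M]%classic.
  change (U (u @^-1` `[- M, M])); apply: (filterS _ (@filterT _ U _)) => i _ /=.
  by rewrite in_itv/= -ler_norml; exact: uM.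
move=> /(_ _ UuU uMU)[l [/=]]; rewrite in_itv/= -ler_norml => lM ul.
by exists l.
Qed.

Section operator_limits.
Variables (R : realType) (G : groupType) (X : normedModType R).
Local Notation L := (bounded_op X (linfty R G)).

Lemma le_op_pointwise (T : L) (M : R) x h : `|T| <= M -> `|T x h| <= M * `|x|.
Proof.
move=> TM; apply: le_trans (le_linfty_norm _ _) _.
by apply: le_trans (le_op_norm T _) _; exact: ler_wpM2r.
Qed.

(** Limits are chosen separately at each [x] and [h]. The bound [M * |x|], uniform in [h], makes the
    limit an element of [linfty] and controls its operator norm; uniqueness of limits gives
    linearity. *)
Lemma bounded_op_ultralimit (I : Type) (U : set_system I) {UU : UltraFilter U}
    (T_ : I -> L) (M : R) : (forall i, `|T_ i| <= M) ->
  exists T : L, `|T| <= M /\ forall x h, T_ i x h @[i --> U] --> T x h.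
Proof.
move=> TM.
have lim x h : {l | `|l| <= M * `|x| & T_ i x h @[i --> U] --> l}.
  apply/cid2; apply: ultrafilter_bounded_cvg => i.
  exact: le_op_pointwise.
pose l x h := s2val (lim x h).
have lM x h : `|l x h| <= M * `|x| by rewrite /l; case: (lim x h).
have lcvg x h : T_ i x h @[i --> U] --> l x h by rewrite /l; case: (lim x h).
have lb x : l x \in @bounded_pred R G.
  by apply: bounded_predP; exists (M * `|x|) => h.
pose f x := Linfty (lb x).
(* As [U] is proper, [I] is inhabited, and [M] dominates some norm. *)
have M0 : 0 <= M.
  have [i _] := filter_ex (@filterT _ U _).
  exact: le_trans (op_norm_ge0 (T_ i)) (TM i).
have fb : f \in @bounded_op_pred R X (linfty R G).
  apply: bounded_op_predP => [a x y|]; last first.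
    exists M => x; apply: linfty_norm_le => h; exact: lM.
  apply/val_inj/funext => h /=.
  apply: (cvg_unique _ (lcvg _ _)) => //.
  rewrite (_ : (fun i => _) = fun i => a *: T_ i x h + T_ i y h); last first.
    by apply/funext => i; rewrite bounded_op_linear.
  apply: cvgD; last exact: lcvg.
  by apply: cvgZr; exact: lcvg.
exists (BoundedOp fb); split=> //.
by apply: op_norm_le => // x; apply: linfty_norm_le => h; exact: lM.
Qed.

(** Every neighbourhood of [s] contains the preimage of an open set around [f s]. *)
Lemma cvg_initial_topology (S : choiceType) (T : topologicalType) (f : S -> T)
    (F : set_system S) (s : S) : Filter F ->
  f @ F --> f s -> F --> (s : initial_topology f).
Proof.
move=> FF fF A; rewrite /= nbhsE => -[_ [[B oB <-] Bfs] BA].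
by apply: filterS BA _; apply: fF; exact: open_nbhs_nbhs.
Qed.

(** The weak-* topology is initial twice over: along the pairing into a product, whose topology is
    itself the supremum of those induced by the evaluations. Convergence can thus be tested at each
    [xi]. *)
Lemma weak_star_closed_cvg (E : set L) (I : Type) (F : set_system I)
    {FF : ProperFilter F} (T_ : I -> L) (T : L) :
  weak_star_closed E -> (forall i, E (T_ i)) ->
  (forall xi : {xi : G -> X | l1 xi},
    l1_pairing (T_ i) xi @[i --> F] --> l1_pairing T xi) -> E T.
Proof.
move=> Ecl ET cvgT.
pose V : topologicalType := initial_topology
  (@l1_pairing R G X : L -> {ptws {xi : G -> X | l1 xi} -> R}).
have cvgV : T_ i @[i --> F] --> (T : V).
  apply: cvg_initial_topology; apply/cvg_sup => xi.
  apply: (@cvg_initial_topology _ _ (fun u : {ptws _ -> R} => u xi)).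
  exact: cvgT.
by apply: (@closed_cvg _ V F FF T_ E Ecl _ T cvgV); exact: nearW.
Qed.

(** Dominated convergence applies to the pairing with each [xi], with dominating function
    [M * |xi g|], summable because [xi] is in [l1]. *)
Lemma weak_star_closed_pointwise (E : set L) (I : Type) (F : set_system I)
    {FF : ProperFilter F} (T_ : I -> L) (T : L) (M : R) :
  weak_star_closed E -> (forall i, E (T_ i)) ->
  (forall i, `|T_ i| <= M) -> `|T| <= M ->
  (forall x h, T_ i x h @[i --> F] --> T x h) -> E T.
Proof.
move=> Ecl ET T_M TM cvgT.
apply: (@weak_star_closed_cvg E I F FF T_ T Ecl ET) => xi.
pose c g := M * `|sval xi g|.
apply: (@dominated_signed_esum_cvg _ _ _ F _ (fun i g => T_ i (sval xi g) g)
  (fun g => T (sval xi g) g) c) => [|i g|g|g].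
- have M0 : 0 <= M by exact: le_trans (op_norm_ge0 T) TM.
  have xi1 := svalP xi; rewrite /l1 /= summableE in xi1.
  apply: le_lt_trans
    (ltry (M * fine (\esum_(g in [set: G]) `|(`|sval xi g|)%:E|)%E)).
  apply: ge_ereal_sup => _ [A [finA _] <-].
  rewrite fsumEFin// lee_fin -mulr_fsumr ler_wpM2l// -lee_fin fineK//.
  rewrite -fsumEFin//; apply: ereal_sup_ubound; exists A => //.
  by apply: eq_fsbigr => g _; rewrite /= normr_id.
- exact: le_op_pointwise.
- exact: le_op_pointwise.
- exact: cvgT.
Qed.

End operator_limits.

(** * Averages of a cocycle against a partition of unity *)

Lemma lu_norm_fsum (R : realType) (G : groupType) (f : G -> linfty R G)
    (e : R) (A : {fset G}) h :
  (lu_norm f <= e%:E)%E -> \sum_(g <- A) `|f g h| <= e.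
Proof.
move=> fe; rewrite -lee_fin; apply: le_trans fe.
apply: le_trans (ereal_sup_ubound _); last by exists h.
apply: ereal_sup_ubound; exists [set` A] => //.
by rewrite fsumEFin// fsbig_finite// set_fsetK.
Qed.

Section averages.
Variables (R : realType) (G : groupType) (X : normedModType R).
Local Notation C := (linfty R G).
Local Notation L := (bounded_op X C).
Variables (Phi : bounded_gmodule G X) (E : set L).
Hypothesis hE : hopf_gmodule Phi E.

Lemma bounded_opDE (T U : L) x h : (T + U) x h = T x h + U x h.
Proof. by []. Qed.

Lemma hopf_act1 (T : L) : hopf_act Phi 1%g T = T.
Proof.
apply/val_inj/funext => x; apply/val_inj/funext => h /=.
by rewrite invg1 gact1 mul1g.
Qed.

Lemma hopf_actM g k (T : L) :
  hopf_act Phi (g * k)%g T = hopf_act Phi g (hopf_act Phi k T).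
Proof.
apply/val_inj/funext => x; apply/val_inj/funext => h /=.
by rewrite invgM gactM mulgA.
Qed.

Lemma hopf_actB g (T U : L) :
  hopf_act Phi g (T - U) = hopf_act Phi g T - hopf_act Phi g U.
Proof. by apply/val_inj/funext => x; apply/val_inj/funext. Qed.

Lemma hopf_sum (I : Type) (s : seq I) (T : I -> L) :
  (forall i, E (T i)) -> E (\sum_(i <- s) T i).
Proof.
move=> ET; elim/big_rec: _ => [|i U _ EU]; first exact: hopf0 hE.
by rewrite -[T i]scale1r; apply: (hopf_linear hE).
Qed.

Lemma hopfB (T U : L) : E T -> E U -> E (T - U).
Proof. by move=> ET EU; rewrite addrC -scaleN1r; apply: (hopf_linear hE). Qed.

(** The operators [T_n] of the overview. For [xi] of infinite support [fset_set] is empty and the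
    value is [0]. *)
Definition average (xi : G -> C) (b : G -> L) : L :=
  \sum_(g <- fset_set [set g | xi g <> 0]) hopf_scale (xi g) (b g).

Lemma average_in xi b : (forall g, E (b g)) -> E (average xi b).
Proof. by move=> Eb; apply: hopf_sum => g; exact: (hopf_scaleP hE). Qed.

(** The freedom in [A] allows averages and their translates to be compared over a common index
    set. *)
Lemma averageE xi b x h (A : {fset G}) : finitely_supported xi ->
  (forall g, xi g <> 0 -> g \in A) ->
  average xi b x h = \sum_(g <- A) xi g h * b g x h.
Proof.
move=> xifin xiA.
pose A0 := fset_set [set g | xi g <> 0].
have -> : average xi b x h = \sum_(g <- A0) xi g h * b g x h.
  by rewrite /average; elim/big_rec2: _ => // g u T _ <-.
rewrite -(fsbigTE A0) => [|g]; last first.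
  by rewrite in_fset_set// notin_setE /= => /contrapT ->; rewrite mul0r.
apply: fsbigTE => g gA.
have -> : xi g = 0 by apply: contrapT => /xiA; rewrite (negbTE gA).
by rewrite mul0r.
Qed.

Lemma partition_of_unityE (xi : G -> C) h (A : {fset G}) :
  (forall g, xi g <> 0 -> g \in A) ->
  \sum_(g \in [set: G]) xi g = linfty_one R G ->
  \sum_(g <- A) xi g h = 1.
Proof.
move=> xiA; rewrite (fsbigTE A) => [/(congr1 (fun f : C => f h)) /= <-|g gA].
  by elim/big_rec2: _ => // g u f _ ->.
by apply: contrapT => /xiA; rewrite (negbTE gA).
Qed.

(* The cocycle identity gives
   [s . average xi b - average xi b + b s = \sum_g (s * xi - xi) g . b g]. *)
Lemma average_defect xi b s (e M : R) : finitely_supported xi ->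
  \sum_(g \in [set: G]) xi g = linfty_one R G ->
  (lu_norm (xi - lu_act s xi)%R <= e%:E)%E ->
  (forall g, `|b g| <= M) ->
  (forall g h, b (g * h)%g = hopf_act Phi g (b h) + b g) ->
  forall x h,
  `|average xi b (Phi s^-1%g x) (s^-1 * h)%g - average xi b x h + b s x h| <=
  e * (M * `|x|).
Proof.
move=> xifin xi1 xie bM bmul x h.
pose A0 := fset_set [set g | xi g <> 0].
have xiA0 g : xi g <> 0 -> g \in A0.
  by move=> xig; rewrite in_fset_set//; exact/mem_set.
(* [A] contains the support of [xi] and its translate by [s], so both [A] and [A' = s^-1 A] contain
   the support, and a sum over [A'] reindexes to one over [A]. *)
pose A := (A0 `|` [fset (s * g)%g | g in A0])%fset.
have xiA g : xi g <> 0 -> g \in A.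
  by move=> /xiA0 gA; rewrite in_fsetU gA.
pose A' := [fset (s^-1 * g)%g | g in A]%fset.
have xiA' g : xi g <> 0 -> g \in A'.
  move=> /xiA0 gA; apply/imfsetP; exists (s * g)%g; last by rewrite mulKg.
  by rewrite /= in_fsetU; apply/orP; right; apply/imfsetP; exists g.
have reindex (F : G -> R) :
    \sum_(g <- A') F g = \sum_(g <- A) F (s^-1 * g)%g.
  by rewrite big_imfset//= => g k _ _; exact: mulgI.
(* The cocycle identity for [k = s (s^-1 k)], evaluated at [x] and [h]. *)
have bs k : b (s^-1 * k)%g (Phi s^-1%g x) (s^-1 * h)%g = b k x h - b s x h.
  have -> : b k = hopf_act Phi s (b (s^-1 * k)%g) + b s.
    by rewrite -bmul mulVKg.
  by rewrite bounded_opDE addrK.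
have one := partition_of_unityE (s^-1 * h)%g xiA' xi1.
rewrite reindex in one.
rewrite (averageE _ _ _ xifin xiA') (averageE _ _ _ xifin xiA) reindex.
(* The weights at [s^-1 h] have total mass 1, so [b s x h] leaves the sum with coefficient 1 and
   cancels the last term of the defect. *)
rewrite (_ : \sum_(g <- A) _ = \sum_(g <- A)
    xi (s^-1 * g)%g (s^-1 * h)%g * b g x h - b s x h); last first.
  rewrite -[X in _ = _ - X]mul1r -one mulr_suml -sumrB; apply: eq_bigr => g _.
  by rewrite bs mulrBr.
rewrite addrAC subrK -sumrB; apply: le_trans (ler_norm_sum _ _ _) _.
have M0 : 0 <= M * `|x|.
  by rewrite mulr_ge0// (le_trans _ (bM 1%g))//; exact: op_norm_ge0.
apply: (@le_trans _ _ (\sum_(g <- A) `|(xi - lu_act s xi) g h| * (M * `|x|))).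
  apply: ler_sum => g _; rewrite -mulrBl normrM distrC ler_wpM2l//.
  exact: le_op_pointwise.
by rewrite -mulr_suml ler_wpM2r//; exact: lu_norm_fsum.
Qed.

(** At each [h] the average is a convex combination of the values [b g x h]. *)
Lemma average_norm xi b M : finitely_supported xi ->
  \sum_(g \in [set: G]) xi g = linfty_one R G -> (forall g h, 0 <= xi g h) ->
  (forall g, `|b g| <= M) -> `|average xi b| <= M.
Proof.
move=> xifin xi1 xi0 bM.
have M0 : 0 <= M by rewrite (le_trans _ (bM 1%g))//; exact: op_norm_ge0.
have xiA g : xi g <> 0 -> g \in fset_set [set g | xi g <> 0].
  by move=> xig; rewrite in_fset_set//; exact/mem_set.
apply: op_norm_le => // x; apply: linfty_norm_le => h.
rewrite (averageE _ _ _ xifin xiA); apply: le_trans (ler_norm_sum _ _ _) _.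
rewrite -[leRHS]mul1r -(partition_of_unityE h xiA xi1) mulr_suml.
apply: ler_sum => g _; rewrite normrM ger0_norm// ler_wpM2l//.
exact: le_op_pointwise.
Qed.

End averages.

(** * From almost invariant averages to the vanishing of [H1b] *)

Section vanishing.
Variables (R : realType) (G : groupType) (X : normedModType R).
Local Notation L := (bounded_op X (linfty R G)).
Variables (Phi : bounded_gmodule G X) (E : set L) (S : set G).
Hypothesis hE : hopf_gmodule Phi E.

Lemma exact_bounded_cocycle b : exact_group R S -> weak_star_closed E ->
  bounded_cocycle (hopf_act Phi) E b ->
  exists2 phi, E phi & forall s, S s -> b s = hopf_act Phi s phi - phi.
Proof.
move=> hG hEw [bE [M bM] bmul].
have e0 n : 0 < n.+1%:R^-1 :> R by rewrite invr_gt0.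
have [xi xiP] := choice (fun n => hG _ (e0 n)).
(* [U] refines the filter of cofinal segments, so the defect bound [(n+1)^-1 * (M * |x|)] still
   tends to [0] along it. *)
have [U [UU ooU]] := ultraFilterLemma (@eventually_filter).
have TM n : `|average (xi n) b| <= M.
  by have [_ fin pos one _] := xiP n; exact: average_norm.
have [T [T_M Tcvg]] := bounded_op_ultralimit TM.
have ET : E T.
  apply: (weak_star_closed_pointwise hEw _ TM T_M Tcvg) => n.
  exact: (average_in hE).
exists (0 - T) => [|s Ss]; first exact: (hopfB hE (hopf0 hE)).
apply/val_inj/funext => x; apply/val_inj/funext => h.
have small : average (xi n) b (Phi s^-1%g x) (s^-1 * h)%g
    - average (xi n) b x h + b s x h @[n --> U] --> (0 : R).
  apply: norm_cvg0.
  apply: (@squeeze_cvgr _ _ _ _ (fun=> 0) (fun n => n.+1%:R^-1 * (M * `|x|))).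
  - apply: nearW => n; rewrite normr_ge0/=.
    have [_ fin pos one /(_ s Ss) xin] := xiP n.
    exact: (average_defect (Phi := Phi)).
  - exact: cvg_cst.
  - rewrite -[X in _ --> X](mul0r (M * `|x|)); apply: cvgMr_tmp.
    exact: cvg_trans (cvg_app _ ooU) (@cvg_harmonic R).
have lim : average (xi n) b (Phi s^-1%g x) (s^-1 * h)%g
    - average (xi n) b x h + b s x h @[n --> U] -->
    T (Phi s^-1%g x) (s^-1 * h)%g - T x h + b s x h.
  by apply: cvgD; [apply: cvgB; exact: Tcvg|exact: cvg_cst].
(* Equating the two limits gives [s . T - T + b s = 0] at [x] and [h], which is the claim for
   [phi = 0 - T]. *)
have /(_ _) := cvg_unique (@Rhausdorff R) lim small.
change (T (Phi s^-1%g x) (s^-1 * h)%g - T x h + b s x h = 0 ->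
  b s x h = 0 - T (Phi s^-1%g x) (s^-1 * h)%g - (0 - T x h)).
lra.
Qed.

Lemma exact_cocycle_boundary b : finite_symmetric_generating S ->
  exact_group R S -> weak_star_closed E ->
  bounded_cocycle (hopf_act Phi) E b -> boundary (hopf_act Phi) E b.
Proof.
move=> [_ _ Sgen] hG hEw hb; have [_ _ bmul] := hb.
have [phi Ephi bphi] := exact_bounded_cocycle hG hEw hb.
exists phi => // g.
have b1 : b 1%g = 0.
  by apply: (addrI (b 1%g)); rewrite addr0 -{2}(hopf_act1 Phi (b 1%g)) addrC
    -bmul mulg1.
(* It remains to see that the set where the two cocycles agree is a subgroup. *)
suff : smallest (@is_subgroup G) S `<=`
    [set g | b g = hopf_act Phi g phi - phi].
  by rewrite Sgen; exact.
apply: smallest_sub => //; split=> /=.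
- by rewrite b1 hopf_act1 subrr.
- move=> x y bx by_; rewrite bmul bx by_ hopf_actB hopf_actM.
  by rewrite addrA subrK.
- move=> x bx; have := bmul x^-1%g x; rewrite mulVg b1 bx hopf_actB -hopf_actM.
  by rewrite mulVg hopf_act1 => /esym/eqP; rewrite addrC addr_eq0 opprB => /eqP.
Qed.

Lemma exact_H1b_eq0 : finite_symmetric_generating S -> exact_group R S ->
  weak_star_closed E -> H1b_eq0 (hopf_act Phi) E.
Proof.
move=> hS hG hEw.
have bnd b : bounded_cocycle (hopf_act Phi) E b -> boundary (hopf_act Phi) E b.
  exact: exact_cocycle_boundary.
have act0 g : hopf_act Phi g 0 = 0.
  by rewrite -[X in hopf_act _ _ X](subrr 0) hopf_actB subrr.
have z : bounded_cocycle (hopf_act Phi) E (0 : G -> bounded_op X (linfty R G)).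
  split=> [g||g h]; first exact: hopf0 hE.
  - by exists 0 => g; rewrite normr0.
  - by rewrite [LHS]/(0 : bounded_op X (linfty R G)) act0 addr0.
(* Two boundaries differ by a boundary, so each coset is the whole space of bounded cocycles; the
   zero cocycle [z] ensures that this coset occurs in [H1b]. *)
have classE b : bounded_cocycle (hopf_act Phi) E b ->
    cocycle_class (hopf_act Phi) E b = bounded_cocycle (hopf_act Phi) E.
  move=> /bnd[phi Ephi bphi]; apply/seteqP; split=> [c []//|c hc]; split=> //.
  have [psi Epsi cpsi] := bnd _ hc.
  exists (psi - phi) => [|g]; first by apply: (hopfB hE).
  rewrite (_ : (c - b) g = c g - b g)// hopf_actB cpsi bphi !opprB.
  by rewrite addrACA [RHS]addrACA (addrC (- psi)).
apply/seteqP; split=> [_ [b hb <-]|_ ->]; last by exists 0.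
by rewrite /= !classE.
Qed.

End vanishing.

Theorem theorem1p2 (R : realType) (G : groupType) (S : set G)
    (hS : finite_symmetric_generating S) (hG : exact_group R S)
    (X : completeNormedModType R) (Phi : bounded_gmodule G X)
    (E : set (bounded_op X (linfty R G)))
    (hE : hopf_gmodule Phi E) (hEw : weak_star_closed E) :
  H1b_eq0 (hopf_act Phi) E.
Proof. exact: (exact_H1b_eq0 hE hS hG hEw). Qed.
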